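(* Let $f=\sum_ia_ix^i\in R[x^{\pm1}]$ have unit constant coefficient $a_0\in R^\times$, and let $\alpha\in\mathbb Q$ be positive with $v(a_i)\ge\alpha|i|$ for all $i<0$. Let $f=h^2+g$ be an odd decomposition, and consider the function $$\overline w\colon\ \mathbb Q\cap[0,\alpha]\to\mathbb R,\qquad \lambda\mapsto\overline w(\lambda):=\min\{2,\,w(f(2^\lambda u))\}.$$ (a) The function $\overline w$ is continuous and piecewise linear concave. (b) If $\overline w$ has a horizontal segment, its value there is $2$ and $w(f(2^\lambda u))>2$ for $\lambda$ in the interior of that segment. (c) Let $\lambda\in\mathbb Q$ with $0<\lambda<\alpha$ and set $\gamma:=v(g(2^\lambda u))$. Then $\lambda$ is a break point of $\overline w$ if and only if either $\gamma=2$, or $\gamma<2$ and $[g(2^\lambda u)/2^\gamma]$ is not a monomial.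
   Context: $R_1$ is a complete discrete valuation ring with quotient field $K_1$ of characteristic $0$ and residue field of characteristic $2$; $K$ is an algebraic closure of $K_1$; $R$ is the integral closure of $R_1$ in $K$, a valuation ring with $\mathbb Q$-valued valuation $v$ normalized by $v(2)=1$, maximal ideal $\mathfrak m$, residue field $k=R/\mathfrak m$. A group homomorphism $\mathbb Q\to K^\times$, $\alpha\mapsto2^\alpha$, with $2^1=2$ is fixed, so $v(2^\alpha)=\alpha$. For a Laurent polynomial $f=\sum_i a_ix^i$ over $K$ put $v(f):=\inf_i v(a_i)$; for a Laurent polynomial $f$ over $R$, $[f]$ denotes its residue class modulo $\mathfrak m$. For a Laurent polynomial $f$ over $R$ with $v(f)=0$ put $w(f):=\sup\{v(f-h^2)\}\in\mathbb R\cup\{\infty\}$, where $h$ ranges over Laurent polynomials over $R$ in the same variable. A decomposition $f=h^2+g$ with $g,h\in K[x^{\pm1}]$ is called odd if $g$ contains only monomials with odd exponents (then automatically $g,h\in R[x^{\pm1}]$). For $0\le\lambda\le\alpha$, $f(2^\lambda u)$ is a Laurent polynomial in $u$ with coefficients in $R$ and unit constant coefficient. A break point of a continuous piecewise linear function is a point where the slope changes. *)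

(* Defs.v *)
From HB Require Import structures.
From mathcomp Require Import all_boot all_order all_algebra finmap.
From mathcomp Require Import ring_quotient.
From mathcomp Require Import all_classical all_reals all_analysis.
Import Order.TTheory GRing.Theory Num.Theory.
Import numFieldNormedType.Exports.

Set Implicit Arguments.
Unset Strict Implicit.
Unset Printing Implicit Defensive.

Local Open Scope fset_scope.
Local Open Scope classical_set_scope.
Local Open Scope ring_scope.

(* A Laurent polynomial f is encoded by its coefficient function: f i is the
   coefficient of x^i. *)

Section Laurent.
Variable A : comNzRingType.

Definition laurent := {fsfun int -> A with 0}.
HB.instance Definition _ := Choice.on laurent.
Implicit Types (f g h : laurent) (i j k : int).

Definition lmono (c : A) i : laurent := [fsfun k in [fset i] => c].
Definition lconst (c : A) : laurent := lmono c 0.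

Definition lzero : laurent := [fsfun].
Definition lopp f : laurent := [fsfun k in finsupp f => - f k].
Definition ladd f g : laurent :=
  [fsfun k in (finsupp f `|` finsupp g)%fset => f k + g k].
Definition lmul f g : laurent :=
  [fsfun k in [fset i + j | i in finsupp f, j in finsupp g] =>
    \sum_(i <- finsupp f) f i * g (k - i)].

Lemma lmonoE c i k : lmono c i k = if k == i then c else 0.
Proof. by rewrite fsfunE inE. Qed.

Lemma lzeroE k : lzero k = 0.
Proof. by rewrite fsfunE. Qed.

Lemma loppE f k : lopp f k = - f k.
Proof. by rewrite fsfunE; case: finsuppP => // _; rewrite oppr0. Qed.

Lemma laddE f g k : ladd f g k = f k + g k.
Proof.
rewrite fsfunE in_fsetU; case: (finsuppP f) => // _.
by case: (finsuppP g) => //= _; rewrite addr0.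
Qed.

Lemma lmulE f g k : lmul f g k = \sum_(i <- finsupp f) f i * g (k - i).
Proof.
rewrite fsfunE; case: ifPn => // kNfg.
rewrite big_seq big1 // => i fi; case: (finsuppP g) => [_|gj].
  by rewrite mulr0.
case/negP: kNfg; apply/imfset2P; exists i => //; exists (k - i) => //.
by rewrite addrC subrK.
Qed.

Lemma lmulEl f g (S : {fset int}) k : (finsupp f `<=` S)%fset ->
  lmul f g k = \sum_(i <- S) f i * g (k - i).
Proof.
move=> fS; rewrite lmulE; apply: big_fset_incl => // i _.
by case: finsuppP => // _ _; rewrite mul0r.
Qed.

Lemma lmulEr f g (S : {fset int}) k : (finsupp g `<=` S)%fset ->
  lmul f g k = \sum_(j <- S) f (k - j) * g j.
Proof.
move=> gS; pose T := [fset k - j | j in S].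
have -> : \sum_(j <- S) f (k - j) * g j = \sum_(i <- T) f i * g (k - i).
  rewrite big_imfset /=; last by move=> i j _ _ /addrI /oppr_inj.
  by apply: eq_bigr => j _; rewrite opprB addrCA subrr addr0.
rewrite (@lmulEl f g (finsupp f `|` T)%fset); last exact: fsubsetUl.
apply/esym/big_fset_incl; first exact: fsubsetUr.
move=> i _ iT; case: (finsuppP g) => [_|gj]; first by rewrite mulr0.
case/negP: iT; apply/imfsetP; exists (k - i); first exact: (fsubsetP gS).
by rewrite opprB addrCA subrr addr0.
Qed.

Lemma laddA : associative ladd.
Proof. by move=> f g h; apply/fsfunP => k; rewrite !laddE addrA. Qed.

Lemma laddC : commutative ladd.
Proof. by move=> f g; apply/fsfunP => k; rewrite !laddE addrC. Qed.

Lemma ladd0 : left_id lzero ladd.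
Proof. by move=> f; apply/fsfunP => k; rewrite !laddE lzeroE add0r. Qed.

Lemma laddN : left_inverse lzero lopp ladd.
Proof. by move=> f; apply/fsfunP => k; rewrite laddE loppE lzeroE addNr. Qed.

HB.instance Definition _ := GRing.isZmodule.Build laurent laddA laddC ladd0 laddN.

Lemma lmulC : commutative lmul.
Proof.
move=> f g; apply/fsfunP => k.
rewrite lmulE (@lmulEr g f (finsupp f)) //.
by apply: eq_bigr => i _; rewrite mulrC.
Qed.

Lemma lmulA : associative lmul.
Proof.
move=> f g h; apply/fsfunP => k.
pose S := finsupp g.
rewrite lmulE (@lmulEr _ h (finsupp h)) //.
under [RHS]eq_bigr => l _ do rewrite lmulE big_distrl.
under [LHS]eq_bigr => i _ do rewrite (@lmulEr g h (finsupp h)) // big_distrr.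
rewrite exchange_big /=; apply: eq_bigr => l _; apply: eq_bigr => i _.
by rewrite mulrA addrAC.
Qed.

Lemma lmul1 : left_id (lconst 1) lmul.
Proof.
move=> f; apply/fsfunP => k; rewrite (@lmulEl _ _ [fset 0%R]).
  by rewrite big_seq_fset1 lmonoE eqxx mul1r subr0.
exact: finsupp_sub.
Qed.

Lemma lmulDl : left_distributive lmul ladd.
Proof.
move=> f g h; apply/fsfunP => k; rewrite laddE.
rewrite !(@lmulEr _ h (finsupp h)) // -big_split /=.
by apply: eq_bigr => i _; rewrite laddE mulrDl.
Qed.

Lemma lone_neq0 : lconst 1 != 0.
Proof.
apply/eqP => /fsfunP /(_ 0); rewrite lmonoE eqxx lzeroE.
by apply/eqP; exact: oner_neq0.
Qed.

HB.instance Definition _ :=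
  GRing.Zmodule_isComNzRing.Build laurent lmulA lmulC lmul1 lmulDl lone_neq0.

Definition is_lmonomial f := exists2 c : A, c != 0 & exists i, f = lmono c i.

End Laurent.

(* f(c u), as a Laurent polynomial in u; meant for c != 0 *)
Definition lsubst (K : fieldType) (c : K) (f : laurent K) : laurent K :=
  [fsfun i in finsupp f => f i * c ^ i].

Definition odd_decomposition (K : fieldType) (f h g : laurent K) :=
  f = h ^+ 2 + g /\ forall i, g i != 0 -> ~~ (2 %| i)%Z.

Record valuation (K : fieldType) := Valuation {
  val_fun :> K -> \bar rat ;
  val_neqNy : forall x, val_fun x != -oo%E ;
  val_eqy : forall x, (val_fun x == +oo%E) = (x == 0) ;
  valM : forall x y, val_fun (x * y) = (val_fun x + val_fun y)%E ;
  valD : forall x y, (mine (val_fun x) (val_fun y) <= val_fun (x + y))%E }.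

Section ValuationRing.
Variables (K : fieldType) (v : valuation K).

Lemma val0 : v 0 = +oo%E. Proof. by apply/eqP; rewrite val_eqy. Qed.

Lemma val_fin x : x != 0 -> v x \is a fin_num.
Proof. by move=> x0; rewrite fin_numE val_neqNy val_eqy x0. Qed.

Lemma val1 : v 1 = 0%E.
Proof.
have := valM v 1 1; rewrite mulr1; have := val_fin (oner_neq0 K).
case: (v 1) => // r _ [] /eqP; rewrite -subr_eq0 opprD addrA subrr sub0r oppr_eq0.
by move=> /eqP ->.
Qed.

Lemma valN x : v (- x) = v x.
Proof.
have vN1 : v (-1) = 0%E.
  have := valM v (-1) (-1); rewrite mulrNN mulr1 val1.
  have : (-1 : K) != 0 by rewrite oppr_eq0 oner_neq0.
  move=> /val_fin; case: (v (-1)) => // r _ [] /eqP.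
  by rewrite eq_sym -mulr2n mulrn_eq0 /= => /eqP ->.
by rewrite -mulN1r valM vN1 add0e.
Qed.

Definition vint : {pred K} := [pred x | (0 <= v x)%E].

Lemma vint_subring : subring_closed vint.
Proof.
split; first by rewrite inE val1.
- move=> x y; rewrite !inE => x0 y0; apply: le_trans (valD v x (- y)).
  by rewrite valN le_min x0.
- by move=> x y; rewrite !inE valM => x0 y0; exact: adde_ge0.
Qed.

HB.instance Definition _ := GRing.isSubringClosed.Build K vint vint_subring.

Definition vring := {x : K | x \in vint}.
HB.instance Definition _ := SubChoice.on vring.
HB.instance Definition _ := [SubChoice_isSubComNzRing of vring by <:].

Definition vmax : {pred vring} := [pred x | (0 < v (val x))%E].

Lemma vmax_ideal : idealr_closed vmax.
Proof.
split; first by rewrite inE rmorph0 val0.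
- by rewrite inE rmorph1 val1.
move=> a x y; rewrite !inE rmorphD rmorphM /= => x0 y0.
apply: lt_le_trans (valD v _ _); rewrite lt_min y0 andbT valM.
by have a0 : (0 <= v (val a))%E := valP a; exact: lte_paddl.
Qed.

HB.instance Definition _ := isIdealr.Build vring vmax vmax_ideal.

Definition vres := {ideal_quot vmax}.

(* The junk value 0 is used when x is not in the valuation ring. *)
Definition residue (x : K) : vres := (\pi_vres (insubd (0 : vring) x))%qT.

Definition vunit (x : K) :=
  x \in vint /\ exists2 y, y \in vint & x * y = 1.

(* The infimum over all i is a minimum over the support, since v(0) = +oo. *)
Definition lval (f : laurent K) : \bar rat :=
  \big[mine/+oo%E]_(i <- finsupp f) v (f i).

Definition over_vint (f : laurent K) := forall i, f i \in vint.

(* This is [f] only for f over R, because of the junk value in residue. *)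
Definition lresidue (f : laurent K) : laurent vres :=
  [fsfun i in finsupp f => residue (f i)].

(* This is w(f) for f over the valuation ring. *)
Definition lw (T : realType) (f : laurent K) : \bar T :=
  ereal_sup [set er_map ratr (lval (f - h ^+ 2)) | h in over_vint].

End ValuationRing.

(* two l stands for 2^l. The minimum is finite as soon as f(2^l u) is over the
   valuation ring: w is then nonnegative (take h = 0), so fine loses nothing. *)
Definition wbar (T : realType) (K : fieldType) (v : valuation K)
    (two : rat -> K) (f : laurent K) (l : rat) : T :=
  fine (mine 2%:E (lw v T (lsubst (two l) f))).

(* These notions only see the values of phi at the rational points of [a, b].
   The points of a subdivision belong to the domain of the function, so they are
   rational, while slopes may be real. *)

Section PiecewiseLinear.
Variables (T : realType) (phi : rat -> T).

Definition affine_on (a b : rat) (s : T) :=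
  forall x, a <= x <= b -> phi x = phi a + s * ratr (x - a).

Definition piecewise_linear_on (a b : rat) :=
  exists (n : nat) (t : nat -> rat),
    [/\ t 0%N = a, t n = b, forall i, (i < n)%N -> t i < t i.+1
      & forall i, (i < n)%N -> exists s, affine_on (t i) (t i.+1) s].

Definition concave_on (a b : rat) :=
  forall x y p, a <= x <= b -> a <= y <= b -> 0 <= p <= 1 ->
    ratr p * phi x + ratr (1 - p) * phi y <= phi (p * x + (1 - p) * y).

Definition continuous_on (a b : rat) :=
  {within [set x : rat^o | a <= x <= b], continuous (phi : rat^o -> T)}.

Definition constant_on (a b : rat) := forall x, a <= x <= b -> phi x = phi a.

Definition break_point_on (a b c : rat) :=
  exists c1 c2 : rat, [/\ a <= c1 < c, c < c2 <= b &
    exists s1 s2 : T, [/\ s1 != s2, affine_on c1 c s1 & affine_on c c2 s2]].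

End PiecewiseLinear.

Section DVR.
Variable A : idomainType.

Definition uniformizer (p : A) :=
  [/\ p != 0, p \isn't a GRing.unit &
    forall x, x != 0 -> exists n u, u \is a GRing.unit /\ x = u * p ^+ n].

Definition is_dvr := exists p, uniformizer p.

(* When A is a discrete valuation ring, this is its maximal ideal. *)
Definition nonunits : {pred A} := [pred x | x \isn't a GRing.unit].

Definition adic_close (p : A) (n : nat) (x y : A) :=
  exists c, x - y = c * p ^+ n.

(* Separatedness is not required, since it is automatic for a discrete
   valuation ring. *)
Definition adic_complete :=
  forall p, uniformizer p -> forall x : nat -> A,
    (forall n, exists N, forall i j,
       (N <= i)%N -> (N <= j)%N -> adic_close p n (x i) (x j)) ->
    exists l, forall n, exists N, forall i,
       (N <= i)%N -> adic_close p n (x i) l.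

End DVR.

Arguments nonunits : clear implicits.

(* Main.v *)
(* Write f(2^l u) = H^2 + G for the rescaled odd decomposition. If v(G) < 2, then
   w(f(2^l u)) = v(G): passing to another square (H + e)^2 changes G by
   2He + e^2, and modulo 2 the square e^2 has only even exponents, so it cannot
   cancel G. Hence min(2, w(f(2^l u))) = min(2, v(g(2^l u))) is the lower envelope
   of the constant 2 and of the lines v(g_i) + i l with i odd, all of which have
   nonzero slopes. Such an envelope is concave and piecewise linear, is horizontal
   only where it is the constant 2, and breaks exactly where two of the lines meet
   on it; below 2, the lines meeting at l are the monomials of [G / 2^v(G)]. *)

Require Import Defs.
From HB Require Import structures.
From mathcomp Require Import all_boot all_order all_algebra finmap.
From mathcomp Require Import ring_quotient ring lra zify.
From mathcomp Require Import all_classical all_reals all_analysis.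
Import Order.TTheory GRing.Theory Num.Theory.
Import numFieldNormedType.Exports.

Set Implicit Arguments.
Unset Strict Implicit.
Unset Printing Implicit Defensive.

Local Open Scope classical_set_scope.
Local Open Scope ring_scope.

(** * Lower envelopes of finitely many rational lines *)

Section Envelope.
Implicit Types (p : rat * rat) (s : seq (rat * rat)) (phi : rat -> rat).
Implicit Types (a b c d m x y : rat).

(** A pair is an intercept and a slope; the pairs of interest are (v(g_i), i) and (2, 0). *)
Definition line_at p x : rat := p.1 + p.2 * x.

(** The line [p0] is kept apart so that the family is never empty and the minimum stays rational. *)
Definition envelope p0 s x : rat :=
  \big[Num.min/line_at p0 x]_(p <- s) line_at p x.

Lemma envelope_cons p0 p s x :
  envelope p0 (p :: s) x = Num.min (line_at p x) (envelope p0 s x).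
Proof. by rewrite /envelope big_cons. Qed.

Lemma envelope_le p0 s p x : p \in p0 :: s -> envelope p0 s x <= line_at p x.
Proof.
rewrite inE => /predU1P[->|ps]; first exact: bigmin_le_id.
exact: ge_bigmin_seq.
Qed.

Lemma envelope_attained p0 s x :
  exists2 p, p \in p0 :: s & envelope p0 s x = line_at p x.
Proof.
elim: s => [|q s [p ps pE]]; first by exists p0; rewrite ?inE // /envelope big_nil.
rewrite envelope_cons; case: leP => _.
  by exists q; rewrite // !inE eqxx orbT.
by exists p; rewrite // !inE; move: ps; rewrite inE => /orP[->|->]; rewrite ?orbT.
Qed.

(** A line attaining the envelope at the intermediate point lies above it at x and at y. *)
Lemma envelope_concave p0 s x y c : 0 <= c <= 1 ->
  c * envelope p0 s x + (1 - c) * envelope p0 s y <=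
  envelope p0 s (c * x + (1 - c) * y).
Proof.
move=> c01; have [p ps ->] := envelope_attained p0 s (c * x + (1 - c) * y).
have := envelope_le x ps; have := envelope_le y ps; rewrite /line_at; nra.
Qed.

(** Comparing with a line attaining the envelope at y bounds the increase by that slope times x - y;
    the sum of all absolute slopes bounds each of them. *)
Lemma envelope_lipschitz p0 s :
  exists2 L, 0 <= L & forall x y,
    `|envelope p0 s x - envelope p0 s y| <= L * `|x - y|.
Proof.
pose L := \sum_(p <- p0 :: s) `|p.2|.
have pL p : p \in p0 :: s -> `|p.2| <= L.
  by move=> ps; rewrite /L (big_rem p) //= lerDl sumr_ge0.
have L0 : 0 <= L by apply: sumr_ge0.
have half x y : envelope p0 s x - envelope p0 s y <= L * `|x - y|.
  have [p ps ->] := envelope_attained p0 s y.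
  apply: (@le_trans _ _ (p.2 * (x - y))).
    by have := envelope_le x ps; rewrite /line_at; lra.
  by rewrite (le_trans (ler_norm _)) // normrM ler_wpM2r ?pL.
by exists L => // x y; rewrite ler_norml half lerNl opprB distrC half.
Qed.

(** Lines touching the envelope at x coincide with [q], having the same slope; the finitely many
    others are strictly above [q] at x and stay above it nearby. *)
Lemma envelope_locally_line p0 s q x :
  q \in p0 :: s -> envelope p0 s x = line_at q x ->
  (forall p, p \in p0 :: s -> line_at p x = line_at q x -> p.2 = q.2) ->
  exists2 d, 0 < d & forall y, `|y - x| <= d -> envelope p0 s y = line_at q y.
Proof.
move=> qs qE uq.
suff [d d0 dP] : exists2 d, 0 < d & forall y, `|y - x| <= d ->
    forall p, p \in p0 :: s -> line_at q y <= line_at p y.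
  exists d => // y xy; apply/le_anti; rewrite envelope_le //=.
  by have [p ps ->] := envelope_attained p0 s y; exact: dP.
(* Only the list being traversed is generalized; its members remain lines of the full envelope. *)
have : {subset p0 :: s <= p0 :: s} by [].
elim: {1 3}(p0 :: s) => [|p t IHt] ts; first by exists 1.
have [|d d0 dP] := IHt; first by move=> r rt; apply: ts; rewrite inE rt orbT.
have ps : p \in p0 :: s by apply: ts; rewrite mem_head.
suff [e e0 eP] : exists2 e, 0 < e &
    forall y, `|y - x| <= e -> line_at q y <= line_at p y.
  exists (Num.min d e) => [|y]; first by rewrite lt_min d0.
  rewrite le_min => /andP[yd ye] r; rewrite inE => /predU1P[->|]; first exact: eP.
  exact: dP.
have := envelope_le x ps; rewrite qE le_eqVlt => /predU1P[E|lt].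
  by exists 1 => // y _; have := uq _ ps (esym E); move: E; rewrite /line_at; nra.
have D0 : 0 < 1 + `|q.2 - p.2| by rewrite ltr_pwDl.
(* The radius is the gap at x over the relative slope; the added 1 keeps the denominator
   positive. *)
exists ((line_at p x - line_at q x) / (1 + `|q.2 - p.2|)).
  by rewrite divr_gt0 // subr_gt0.
move=> y; rewrite ler_pdivlMr // => H.
have := ler_norm ((q.2 - p.2) * (y - x)); rewrite normrM mulrC.
have := normr_ge0 (y - x).
by move: H; rewrite /line_at; set u := `|_ - x|; set w := `|_ - p.2|; nra.
Qed.

Definition affine phi a b m := forall x, a <= x <= b -> phi x = phi a + m * (x - a).

(** Subdivisions without indices: taking a minimum with a line may split a piece, which is then a
    mere [Join]. *)
Inductive pieces phi : rat -> rat -> Prop :=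
| Piece a b m : a < b -> affine phi a b m -> pieces phi a b
| Join a b c : pieces phi a b -> pieces phi b c -> pieces phi a c.

Lemma pieces_lt phi a b : pieces phi a b -> a < b.
Proof. by elim=> // {}a {}b c _ ab _; exact: lt_trans. Qed.

Lemma pieces_first phi a b : pieces phi a b ->
  exists c m, a < c <= b /\ affine phi a c m.
Proof.
elim=> [{}a {}b m ab H|{}a {}b c _ [d [m [/andP[ad db] H]]] bc _].
  by exists b, m; rewrite ab lexx.
by exists d, m; rewrite ad (le_trans db) // ltW // (pieces_lt bc).
Qed.

Lemma pieces_last phi a b : pieces phi a b ->
  exists c m, a <= c < b /\ affine phi c b m.
Proof.
elim=> [{}a {}b m ab H|{}a {}b c ab _ _ [d [m [/andP[bd dc] H]]]].
  by exists a, m; rewrite ab lexx.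
by exists d, m; rewrite dc andbT (le_trans _ bd) // ltW // (pieces_lt ab).
Qed.

(** On an affine piece the difference [l] of phi and the line is affine, so it changes sign at most
    once; the piece is cut there if necessary. *)
Lemma pieces_min p phi a b : pieces phi a b ->
  pieces (fun x => Num.min (line_at p x) (phi x)) a b.
Proof.
elim=> [{}a {}b m|*]; last by apply: Join; eassumption.
pose l x := phi x - line_at p x => lt_ab phiE.
have lE x : a <= x <= b -> l x = l a + (m - p.2) * (x - a).
  by move=> /phiE xE; rewrite /l xE /line_at; ring.
(* If [l] has no sign change between c and d, interpolation fixes its sign on the whole interval, so
   the minimum is phi throughout or the line throughout. *)
have min_piece c d : a <= c -> c < d -> d <= b -> 0 <= l c * l d ->
    pieces (fun x => Num.min (line_at p x) (phi x)) c d.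
  move=> ac cd db lcd; have cI : a <= c <= b by lra.
  have dI : a <= d <= b by lra.
  have conv x : c <= x <= d -> l x * (d - c) = l c * (d - x) + l d * (x - c).
    by move=> xcd; rewrite (lE x) ?(lE c) ?(lE d) //; [ring | lra].
  have dc : 0 < d - c by rewrite subr_gt0.
  have ccd : c <= c <= d by rewrite lexx ltW.
  have [lc|lc] := leP (l c + l d) 0.
    have lc0 : l c <= 0 by nra.
    have ld0 : l d <= 0 by nra.
    have E x : c <= x <= d -> Num.min (line_at p x) (phi x) = phi x.
      move=> xcd; rewrite min_r // -subr_le0 -/(l x) -(pmulr_lle0 _ dc) conv //; nra.
    apply: (@Piece _ _ _ m) => // x xcd; have xI : a <= x <= b by lra.
    by rewrite !E // (phiE x) // (phiE c) //; ring.
  have lc0 : 0 <= l c by nra.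
  have ld0 : 0 <= l d by nra.
  have E x : c <= x <= d -> Num.min (line_at p x) (phi x) = line_at p x.
    move=> xcd; rewrite min_l // -subr_ge0 -/(l x) -(pmulr_lge0 _ dc) conv //; nra.
  apply: (@Piece _ _ _ p.2) => // x xcd.
  by rewrite !E // /line_at; ring.
have [lab|lab] := leP 0 (l a * l b); first exact: min_piece.
have lb : l b = l a + (m - p.2) * (b - a) by rewrite lE ?lexx ?ltW.
have la0 : l a != l b by apply/eqP => E; move: lab; rewrite E; nra.
(* The zero of [l], strictly inside the piece because [l a] and [l b] have opposite signs. *)
pose z := a + (b - a) * (l a / (l a - l b)).
have t01 : 0 < l a / (l a - l b) < 1.
  have [la|la] := ltP 0 (l a).
    have lb0 : l b < 0 by nra.
    by rewrite divr_gt0 ?ltr_pdivrMr ?mul1r; lra.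
  have lb0 : 0 < l b by nra.
  rewrite -mulrNN -invrN divr_gt0 ?ltr_pdivrMr ?mul1r; nra.
have az : a < z by rewrite /z; nra.
have zb : z < b by rewrite /z; nra.
have lz : l z = 0.
  have za : z - a = (b - a) * (l a / (l a - l b)) by rewrite /z; ring.
  rewrite lE ?ltW // za mulrA.
  have -> : (m - p.2) * (b - a) = l b - l a by rewrite lb; ring.
  by field; rewrite subr_eq0.
apply: (@Join _ _ z); apply: min_piece => //; try exact: ltW.
  by rewrite lz mulr0.
by rewrite lz mul0r.
Qed.

Lemma pieces_envelope p0 s a b : a < b -> pieces (envelope p0 s) a b.
Proof.
move=> ab; elim: s => [|p s IHs].
  by apply: (@Piece _ _ _ p0.2) => // x _; rewrite /envelope !big_nil /line_at; ring.
rewrite (_ : envelope _ _ = fun x => Num.min (line_at p x) (envelope p0 s x)).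
  exact: pieces_min.
by apply/funext => x; exact: envelope_cons.
Qed.

End Envelope.

(** * Continuity, concavity, piecewise linearity and break points of real-valued envelopes *)

Section RealEnvelope.
Variables (T : realType) (phi : rat -> T) (p0 : rat * rat) (s : seq (rat * rat)).
Variables (a b : rat).
Hypothesis phiE : forall x, a <= x <= b -> phi x = ratr (envelope p0 s x).

Lemma ratr_envelope_continuous :
  continuous ((fun x => ratr (envelope p0 s x)) : rat^o -> T).
Proof.
have [L L0 lip] := envelope_lipschitz p0 s.
move=> x; apply/(@cvgrPdist_lt T T) => e e0.
(* Balls in the domain have rational radii, so the real e is replaced by a smaller positive
   rational. *)
have [q] := rat_in_itvoo e0; rewrite in_itv /= => /andP[q0 qe].
rewrite ltr0q in q0; have L1 : 0 < 1 + L by rewrite ltr_pwDl.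
exists (q / (1 + L)); first by rewrite /= divr_gt0.
move=> y; rewrite /= ltr_pdivlMr // => xy.
apply: le_lt_trans qe; rewrite -rmorphB -ratr_norm ler_rat.
apply: (le_trans (lip x y)); apply: le_trans (ltW xy).
by rewrite mulrC ler_wpM2l // lerDr.
Qed.

Lemma envelope_continuous_on : continuous_on phi a b.
Proof.
have H : continuous_on (fun x => ratr (envelope p0 s x) : T) a b.
  by apply: continuous_subspaceT => x; exact: ratr_envelope_continuous.
apply: subspace_eq_continuous H => x; rewrite inE /= => xab.
by apply: esym; exact: phiE.
Qed.

Lemma envelope_concave_on : concave_on phi a b.
Proof.
move=> x y c xI yI c01; rewrite !phiE //; last first.
  by apply/andP; split; nra.
by rewrite -!rmorphM -rmorphD ler_rat envelope_concave.
Qed.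

Lemma piecewise_linear_join c d e :
  piecewise_linear_on phi c d -> piecewise_linear_on phi d e ->
  piecewise_linear_on phi c e.
Proof.
move=> [n [t [t0 tn tlt taff]]] [n' [t' [t'0 t'n tlt' taff']]].
(* The two descriptions of the concatenated subdivision overlap at index n, where both give the
   common endpoint d. *)
have [u uEl uE] : exists2 u : nat -> rat,
    forall i, (i <= n)%N -> u i = t i & forall i, (n <= i)%N -> u i = t' (i - n)%N.
  exists (fun i => if (i <= n)%N then t i else t' (i - n)%N) => i; first by move=> ->.
  rewrite leq_eqVlt => /predU1P[<-|]; first by rewrite leqnn subnn tn t'0.
  by rewrite ltnNge => /negbTE ->.
exists (n + n')%N, u; split.
- by rewrite uEl.
- by rewrite uE ?leq_addr // addKn.
- move=> i ilt; have [ni|ni] := ltnP i n.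
    by rewrite (uEl _ (ltnW ni)) (uEl _ ni); exact: tlt.
  rewrite (uE _ ni) (uE _ (leqW ni)) subSn //; apply: tlt'.
  by rewrite ltn_subLR.
- move=> i ilt; have [ni|ni] := ltnP i n.
    by rewrite (uEl _ (ltnW ni)) (uEl _ ni); exact: taff.
  rewrite (uE _ ni) (uE _ (leqW ni)) subSn //; apply: taff'.
  by rewrite ltn_subLR.
Qed.

Lemma affine_onE c d m : a <= c -> c <= d -> d <= b ->
  affine (envelope p0 s) c d m -> affine_on phi c d (ratr m).
Proof.
move=> ac cd db aff x xcd; have xI : a <= x <= b by lra.
have cI : a <= c <= b by lra.
by rewrite (phiE xI) (phiE cI) aff // rmorphD rmorphM.
Qed.

Lemma pieces_piecewise_linear c d : a <= c -> d <= b ->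
  pieces (envelope p0 s) c d -> piecewise_linear_on phi c d.
Proof.
move=> ac db H; elim: H ac db => {c d} [c d m cd aff|c d e cd IHc de IHd] ac eb.
  exists 1%N, (fun i => if i == 0%N then c else d); split=> // -[] // _.
  by exists (ratr m); apply: affine_onE => //; exact: ltW.
have := pieces_lt cd; have := pieces_lt de => lt1 lt2.
by apply: (piecewise_linear_join (IHc _ _) (IHd _ _)) => //; lra.
Qed.

Lemma envelope_piecewise_linear_on : a < b -> piecewise_linear_on phi a b.
Proof. by move=> ab; apply: pieces_piecewise_linear => //; exact: pieces_envelope. Qed.

(** A line touching at x lies above the envelope on both sides, so its slope is at most the left
    slope and at least the right one; equal one-sided slopes leave a single slope for touching
    lines. Conversely, if all touching lines share a slope, the envelope is one line near x. *)
Lemma envelope_break_point x : a < x < b ->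
  break_point_on phi a b x <->
  exists p q, [/\ p \in p0 :: s, q \in p0 :: s, p.2 != q.2,
    line_at p x = envelope p0 s x & line_at q x = envelope p0 s x].
Proof.
move=> /andP[ax xb]; split=> [[c1 [c2 [/andP[ac1 c1x] /andP[xc2 c2b]]]]|]; last first.
  move=> [p [q [ps qs pq pE qE]]].
  have [c1 [m1 [/andP[ac1 c1x] aff1]]] := pieces_last (pieces_envelope p0 s ax).
  have [c2 [m2 [/andP[xc2 c2b] aff2]]] := pieces_first (pieces_envelope p0 s xb).
  exists c1, c2; split; rewrite ?ac1 ?xc2 //; exists (ratr m1), (ratr m2); split.
  - rewrite (inj_eq (fmorph_inj _)); apply: contra_neq pq => m12.
    have slopes r : r \in p0 :: s -> line_at r x = envelope p0 s x -> r.2 = m1.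
      move=> rs; rewrite (aff1 x) ?lexx ?andbT ?(ltW c1x) // => rE.
      have := envelope_le c1 rs; have := envelope_le c2 rs.
      rewrite (aff2 c2) ?lexx ?andbT ?(ltW xc2) // (aff1 x) ?lexx ?(ltW c1x) // -m12.
      move: rE; rewrite /line_at; set A := envelope p0 s c1 => rE H1 H2.
      have {}H1 : 0 <= (r.2 - m1) * (c2 - x) by lra.
      have {}H2 : 0 <= (m1 - r.2) * (x - c1) by lra.
      by rewrite !pmulr_lge0 ?subr_gt0 // in H1 H2; lra.
    by rewrite (slopes p) // (slopes q).
  - by apply: affine_onE => //; lra.
  - by apply: affine_onE => //; lra.
move=> [s1 [s2 [s12 aff1 aff2]]]; apply: contrapT => nex.
have [q qs qE] := envelope_attained p0 s x.
have [p ps pE|d d0 dE] := envelope_locally_line qs qE.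
  apply: contrapT => /eqP pq; apply: nex; exists p, q; split=> //.
  by rewrite pE.
have line y : ratr (line_at q y) = ratr q.1 + ratr q.2 * ratr y :> T.
  by rewrite rmorphD rmorphM.
case/eqP: s12; transitivity (ratr q.2 : T).
  (* A point y left of x, close enough for both the affine piece and the local line to apply;
     comparing them at x and y identifies the slopes. *)
  have [y /andP[c1y yx] yd] : exists2 y, c1 <= y < x & `|y - x| <= d.
    have m0 : 0 < Num.min d (x - c1) by rewrite lt_min d0 subr_gt0.
    have md : Num.min d (x - c1) <= d by rewrite ge_min lexx.
    have mc : Num.min d (x - c1) <= x - c1 by rewrite ge_min lexx orbT.
    exists (x - Num.min d (x - c1)); first by lra.
    by rewrite addrAC subrr sub0r normrN gtr0_norm.
  have := aff1 x; have := aff1 y.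
  rewrite c1y (ltW yx) (ltW c1x) lexx => /(_ isT) E1 /(_ isT).
  rewrite phiE ?(dE x) ?subrr ?normr0 ?(ltW d0) //; last by lra.
  move: E1; rewrite phiE ?(dE y) //; last by lra.
  rewrite !line !rmorphB /= => E1 E2.
  have xy : ratr y < ratr x :> T by rewrite ltr_rat.
  apply: (@mulIf _ (ratr x - ratr y)); first by rewrite subr_eq0 gt_eqF.
  by lra.
have [y /andP[xy yc2] yd] : exists2 y, x < y <= c2 & `|y - x| <= d.
  have m0 : 0 < Num.min d (c2 - x) by rewrite lt_min d0 subr_gt0.
  have md : Num.min d (c2 - x) <= d by rewrite ge_min lexx.
  have mc : Num.min d (c2 - x) <= c2 - x by rewrite ge_min lexx orbT.
  exists (x + Num.min d (c2 - x)); first by lra.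
  by rewrite addrAC subrr add0r gtr0_norm.
have := aff2 y; rewrite yc2 (ltW xy) => /(_ isT).
rewrite !phiE ?(dE x) ?(dE y) ?subrr ?normr0 ?(ltW d0) //; try lra.
rewrite !line !rmorphB /= => E1.
have rxy : ratr x < ratr y :> T by rewrite ltr_rat.
apply: (@mulIf _ (ratr y - ratr x)); first by rewrite subr_eq0 gt_eqF.
by lra.
Qed.

End RealEnvelope.

(** * Coefficients of products and squares of Laurent polynomials *)

Section LaurentCoefficients.
Variable A : comNzRingType.
Implicit Types (f g e : laurent A) (i j k : int).

Lemma laurentD f g k : (f + g) k = f k + g k. Proof. exact: laddE. Qed.

Lemma laurentN f k : (- f) k = - f k. Proof. exact: loppE. Qed.

Lemma laurentB f g k : (f - g) k = f k - g k.
Proof. by rewrite laurentD laurentN. Qed.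

Lemma laurentM f g k : (f * g) k = \sum_(i <- finsupp f) f i * g (k - i).
Proof. exact: lmulE. Qed.

Lemma lconstM c f k : (lconst c * f) k = c * f k.
Proof.
rewrite [LHS](@lmulEl _ _ _ [fset 0%R]%fset); last exact: finsupp_sub.
by rewrite big_seq_fset1 lmonoE eqxx subr0.
Qed.

(* The terms e i * e (k - i) and e (k - i) * e i cancel in pairs modulo 2, up to
   the middle one. *)
Lemma laurent_sqrE e k : exists2 S : {fset int}, (finsupp e `<=` S)%fset &
  (e ^+ 2) k =
               \sum_(i <- S | i == k - i) e i ^+ 2 +
               2%:R * \sum_(i <- S | i < k - i) e i * e (k - i).
Proof.
(* Adding the reflected support makes [S] stable under i -> k - i, which exchanges the two halves of
   the sum. *)
pose S := (finsupp e `|` [fset (k - i)%R | i in finsupp e])%fset.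
exists S; first exact: fsubsetUl.
rewrite expr2 [LHS](@lmulEl _ _ _ S); last exact: fsubsetUl.
have ST : S = [fset (k - i)%R | i in S]%fset.
  apply/fsetP => j; apply/idP/imfsetP => [jS|[i iS ->]].
    exists (k - j); last by rewrite /= opprB addrCA subrr addr0.
    move: jS; rewrite !inE => /orP[jS|/imfsetP[i iS ->]].
      by apply/orP; right; apply/imfsetP; exists j.
    by rewrite opprB addrCA subrr addr0 iS.
  move: iS; rewrite !inE => /orP[jS|/imfsetP[j' iS ->]].
    by apply/orP; right; apply/imfsetP; exists i.
  by rewrite opprB addrCA subrr addr0 iS.
rewrite (bigID (fun i => i == k - i)) /=; congr (_ + _).
  by apply: eq_bigr => i /eqP <-; rewrite expr2.
rewrite (bigID (fun i => i < k - i)) /= mulr2n mulrDl mul1r; congr (_ + _).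
  by apply: eq_bigl => i; rewrite andbC; case: ltgtP.
rewrite {1}ST big_mkcond big_imfset /=; last by move=> i j _ _ /addrI /oppr_inj.
rewrite -big_mkcond /=; apply: eq_big => [i|i _].
  by rewrite opprB addrCA subrr addr0; case: ltgtP.
by rewrite opprB addrCA subrr addr0 mulrC.
Qed.

End LaurentCoefficients.

(** * Valuations of squares, and the truncated value min(2, w) *)

Section Valuation.
Variables (K : fieldType) (v : valuation K).
Implicit Types (x y : K) (c r : rat).

Lemma val_sum_ge (I : Type) (s : seq I) (P : pred I) (F : I -> K) (t : \bar rat) :
  (forall i, P i -> (t <= v (F i))%E) -> (t <= v (\sum_(i <- s | P i) F i)%R)%E.
Proof.
move=> Ft; elim/big_rec: _ => [|i x Pi tx]; first by rewrite val0 leey.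
by apply: le_trans (valD v _ _); rewrite le_min Ft.
Qed.

Lemma val_addl x y : (v x < v y)%E -> v (x + y) = v x.
Proof.
move=> xy; apply/le_anti/andP; split; last first.
  by apply: le_trans (valD v _ _); rewrite le_min lexx ltW.
rewrite leNgt; apply/negP => lt.
have := valD v (x + y) (- y); rewrite addrK valN leNgt => /negP; apply.
by rewrite lt_min lt.
Qed.

Lemma val_eq x : x != 0 -> exists r, v x = r%:E.
Proof. by move=> /(val_fin v)/fineK <-; exists (fine (v x)). Qed.

Lemma lval_le (f : laurent K) i : (lval v f <= v (f i))%E.
Proof.
case: (finsuppP f) => [_|fi]; first by rewrite val0 leey.
exact: (@ge_bigmin_seq _ _ _ _ _ i xpredT).
Qed.

Lemma lval_attained (f : laurent K) r : lval v f = r%:E -> exists i, v (f i) = r%:E.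
Proof.
rewrite /lval; elim/big_rec: _ => // i t _ IH; rewrite minEle.
by case: ifP => // _ E; exists i.
Qed.

(** Since v never takes the value -oo, a non-rational minimum must be +oo. *)
Lemma lval_eq0 (f : laurent K) : (forall r, lval v f != r%:E) -> f = 0.
Proof.
move=> fr; apply/fsfunP => i; rewrite [RHS]lzeroE; apply/eqP; rewrite -(val_eqy v).
have : lval v f != -oo%E.
  rewrite /lval; elim/big_rec: _ => // j t _ IH; rewrite minEle.
  by case: ifP => // _; exact: val_neqNy.
have := lval_le f i; move: fr; case: (lval v f) => [r /(_ r)/eqP//||//].
by move=> _; rewrite leye_eq.
Qed.

Lemma over_vintP (f : laurent K) : over_vint v f <-> (0 <= lval v f)%E.
Proof.
split=> [fv|f0 i]; last by rewrite inE (le_trans f0) ?lval_le.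
by apply: le_bigmin => [|i _]; rewrite ?leey //; have := fv i; rewrite inE.
Qed.

Hypothesis v2 : v 2%:R = 1%:E.

(** An odd i is never k + k, so there is no diagonal term and the coefficient is twice a sum of
    products. *)
Lemma sqr_laurent_odd (e : laurent K) r i : (forall k, (r%:E <= v (e k))%E) ->
  ~~ (2 %| i)%Z -> ((1 + r + r)%:E <= v ((e ^+ 2) i)%R)%E.
Proof.
move=> er odd_i; have [S _ ->] := laurent_sqrE e i.
rewrite big_pred0 => [|k]; last first.
  apply: contraNF odd_i => /eqP E; apply/dvdzP; exists k.
  by move: E; lia.
rewrite add0r Defs.valM v2 -addrA EFinD leeD2l //; apply: val_sum_ge => k _.
by rewrite Defs.valM EFinD leeD.
Qed.

(** The diagonal term [e j ^+ 2] has valuation 2r, and the factor 2 pushes all other terms to at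
    least 1 + 2r. *)
Lemma sqr_laurent_even (e : laurent K) r j :
  (forall k, (r%:E <= v (e k))%E) -> v (e j) = r%:E -> r < 1 ->
  v ((e ^+ 2) (j *+ 2)) = (r + r)%:E.
Proof.
move=> er ej r1; have [S eS ->] := laurent_sqrE e (j *+ 2).
have jS : j \in S.
  by apply: (fsubsetP eS); rewrite mem_finsupp -(val_eqy v) ej.
rewrite (big_rem j) //= big_seq_cond big1 => [|i /andP[]]; last first.
  rewrite mem_rem_uniq ?fset_uniq // inE => /andP[/eqP ij _] /eqP.
  by move: ij; lia.
have -> : (j == j *+ 2 - j) by lia.
rewrite addr0 val_addl expr2 Defs.valM ej //.
apply: (@lt_le_trans _ _ (1 + (r + r))%:E).
  by rewrite -EFinD lte_fin ltrDr.
rewrite Defs.valM v2 EFinD leeD2l //; apply: val_sum_ge => k _.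
by rewrite Defs.valM EFinD leeD.
Qed.

(** If v(H) = r < 0 were attained at j, the coefficient of index 2j in H^2 would have valuation 2r <
    0, and G has no even coefficient to compensate for it. *)
Lemma odd_decomposition_over_vint (F H G : laurent K) :
  over_vint v F -> odd_decomposition F H G -> over_vint v H /\ over_vint v G.
Proof.
move=> Fv [FE Godd].
have Hv : over_vint v H.
  apply/over_vintP; rewrite leNgt; apply/negP => H0.
  have [r Hr] : exists r, lval v H = r%:E.
    apply: contrapT => nr; suff H_0 : H = 0.
      by move: H0; rewrite H_0 /lval finsupp0 big_nil.
    by apply: lval_eq0 => r; apply/eqP => E; apply: nr; exists r.
  have [j Hj] := lval_attained Hr; move: H0; rewrite Hr lte_fin => r0.
  have := @sqr_laurent_even H r j; rewrite -{1}Hr => /(_ (lval_le H) Hj).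
  move=> /(_ (lt_trans r0 ltr01)) H2.
  have := Fv (j *+ 2); rewrite inE FE laurentD.
  have -> : G (j *+ 2) = 0.
    apply/eqP; apply: contraT => /Godd /negP[].
    by apply/dvdzP; exists j; lia.
  by rewrite addr0 H2 => rr; move: rr; rewrite lee_fin; lra.
split=> // i; have -> : G = F - H ^+ 2 by rewrite FE addrC addKr.
rewrite laurentB expr2 laurentM rpredB ?Fv // rpred_sum // => k _.
by rewrite rpredM ?Hv.
Qed.

(* With e = h - H, the odd coefficients of 2He + e^2 have valuation at least
   1 + v(e), and the smallest of its even ones has valuation 2v(e). Cancelling G
   would need 1 + v(e) <= v(G) < 2 and 2v(e) > v(G), which is impossible. *)
Lemma lval_sub_sqr_le (F H G h : laurent K) :
  over_vint v F -> odd_decomposition F H G -> over_vint v h ->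
  (lval v G < 2%:R%:E)%E -> (lval v (F - h ^+ 2)%R <= lval v G)%E.
Proof.
move=> Fv FHG hv; have [Hv Gv] := odd_decomposition_over_vint Fv FHG.
have [FE Godd] := FHG => G2.
have [c Gc] : exists c, lval v G = c%:E.
  have := (over_vintP G).1 Gv; move: G2.
  by case: (lval v G) => // c _ _; exists c.
have [i Gi] := lval_attained Gc; rewrite Gc lte_fin in G2 *.
rewrite leNgt; apply/negP => lt.
have ltk k : (c%:E < v ((F - h ^+ 2) k)%R)%E := lt_le_trans lt (lval_le _ k).
pose e := h - H; have hE : h = H + e by rewrite /e addrC subrK.
have FhE k : (F - h ^+ 2) k = G k - (2%:R * (H * e) k + (e ^+ 2) k).
  have -> : F - h ^+ 2 = G - (H * e + H * e + e ^+ 2) by rewrite FE hE; ring.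
  by rewrite laurentB !laurentD; ring.
have ev : over_vint v e.
  by move=> k; rewrite laurentB rpredB ?Hv ?hv.
have odd_i : ~~ (2 %| i)%Z by apply: Godd; rewrite -(val_eqy v) Gi.
(* When e = 0 the difference is G itself, whose coefficient at i has valuation exactly c. *)
have [e0|[r er]] : e = 0 \/ exists r, lval v e = r%:E.
  case: (pselect (exists r, lval v e = r%:E)) => [|nr]; [by right|left].
  by apply: lval_eq0 => r; apply/eqP => E; apply: nr; exists r.
  have := ltk i; rewrite FhE e0 mulr0 expr0n /= !lzeroE.
  by rewrite mulr0 addr0 subr0 Gi ltxx.
have re k : (r%:E <= v (e k))%E by rewrite -er lval_le.
have r0 : 0 <= r by rewrite -lee_fin -er; apply/over_vintP.
have He k : ((1 + r)%:E <= v (2%:R * (H * e) k)%R)%E.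
  rewrite Defs.valM v2 EFinD leeD2l // laurentM; apply: val_sum_ge => j _.
  by rewrite Defs.valM -[leLHS]add0e leeD //; have := Hv j; rewrite inE.
have rc : 1 + r <= c.
  rewrite leNgt; apply/negP => cr; have := ltk i.
  rewrite FhE val_addl Gi ?ltxx // valN (lt_le_trans _ (valD v _ _)) // lt_min.
  rewrite (lt_le_trans _ (He i)) ?lte_fin //=.
  by rewrite (lt_le_trans _ (sqr_laurent_odd re odd_i)) // lte_fin; lra.
have [j ej] := lval_attained er; have r1 : r < 1 by lra.
have := ltk (j *+ 2); rewrite FhE.
have -> : G (j *+ 2) = 0.
  apply/eqP; apply: contraT => /Godd /negP[].
  by apply/dvdzP; exists j; lia.
rewrite sub0r valN addrC val_addl (sqr_laurent_even re ej r1) ?lte_fin.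
  by lra.
by rewrite (lt_le_trans _ (He _)) // lte_fin; lra.
Qed.

Lemma lw_ge (T : realType) (F H G : laurent K) :
  over_vint v F -> odd_decomposition F H G ->
  (er_map ratr (lval v G) <= lw v T F)%E.
Proof.
move=> Fv FHG; have [Hv _] := odd_decomposition_over_vint Fv FHG.
apply: ereal_sup_ubound; exists H => //.
by have [-> _] := FHG; rewrite addrC addKr.
Qed.

Lemma er_map_ratr_le (T : realType) (x y : \bar rat) :
  (er_map ratr x <= er_map ratr y :> \bar T)%E = (x <= y)%E.
Proof. by case: x y => [x||] [y||] //=; rewrite ?lee_fin ?ler_rat ?leey ?leNye. Qed.

(** If v(G) >= 2, the competitor H already brings w up to 2; if v(G) < 2, no competitor beats H. *)
Lemma min_lw (T : realType) (F H G : laurent K) :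
  over_vint v F -> odd_decomposition F H G ->
  mine 2%:E (lw v T F) = er_map ratr (mine 2%:R%:E (lval v G)).
Proof.
move=> Fv FHG; have ge := lw_ge T Fv FHG.
have two_map : 2%:E = er_map ratr 2%:R%:E :> \bar T by rewrite /= ratr_nat.
have [G2|G2] := leP 2%:R%:E (lval v G).
  by rewrite min_l -?two_map // (le_trans _ ge) // two_map er_map_ratr_le.
rewrite min_r.
  apply/le_anti; rewrite ge andbT; apply: ge_ereal_sup => _ [h hv <-].
  by rewrite er_map_ratr_le (lval_sub_sqr_le Fv FHG).
rewrite two_map; apply: (@le_trans _ _ (er_map ratr (lval v G))).
  apply: ge_ereal_sup => _ [h hv <-].
  by rewrite er_map_ratr_le (lval_sub_sqr_le Fv FHG).
by rewrite er_map_ratr_le ltW.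
Qed.

End Valuation.

(** Once one nonzero coefficient is known, being a monomial is a condition on the support alone. *)
Lemma is_lmonomialP (A : comNzRingType) (f : laurent A) (i : int) : f i != 0 ->
  is_lmonomial f <-> (forall j, f j != 0 -> j = i).
Proof.
move=> fi; split=> [[c c0 [k fE]]|fP].
  have eqk j : f j != 0 -> j = k by rewrite fE lmonoE; case: (j =P k) => // _; rewrite eqxx.
  by move=> j /eqk ->; rewrite -(eqk _ fi).
exists (f i) => //; exists i; apply/fsfunP => j; rewrite lmonoE.
by case: (j =P i) => [->//|ji]; apply/eqP/contraT => /fP.
Qed.

(** * The substitution x = cu *)

Section Substitution.
Variables (K : fieldType) (c : K).
Hypothesis c0 : c != 0.
Implicit Types (f g h : laurent K) (i k : int).

Lemma lsubstE f i : lsubst c f i = f i * c ^ i.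
Proof. by rewrite fsfunE; case: finsuppP => // _; rewrite mul0r. Qed.

Lemma finsupp_lsubst f : finsupp (lsubst c f) = finsupp f.
Proof.
apply/fsetP => i; rewrite !mem_finsupp lsubstE mulf_eq0 negb_or.
by rewrite [c ^ i == 0]negbTE ?andbT // expfz_neq0.
Qed.

(** Substitution respects products because c^i c^(k-i) = c^k, and it creates no new exponents. *)
Lemma lsubst_odd_decomposition f h g : odd_decomposition f h g ->
  odd_decomposition (lsubst c f) (lsubst c h) (lsubst c g).
Proof.
move=> [-> godd]; split=> [|i]; last first.
  by rewrite lsubstE => /eqP gi; apply: godd; apply/eqP => g0; rewrite g0 mul0r in gi.
apply/fsfunP => k; rewrite laurentD !lsubstE laurentD mulrDl; congr (_ + _).
rewrite !expr2 !laurentM finsupp_lsubst big_distrl; apply: eq_bigr => i _ /=.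
rewrite !lsubstE mulrACA -expfzDr //; congr (_ * c ^ _).
by rewrite addrC subrK.
Qed.

End Substitution.

(** * Residues, valuations of powers of 2, and the lines attached to g *)

Section Residue.
Variables (K : fieldType) (v : valuation K).

Lemma val_inv x r : v x = r%:E -> v x^-1 = (- r)%:E.
Proof.
move=> xr; have x0 : x != 0 by rewrite -(val_eqy v) xr.
have [t xt] := val_eq v (invr_neq0 x0).
have := Defs.valM v x x^-1; rewrite mulfV // Defs.val1 xr xt -EFinD => -[] E.
by congr _%:E; lra.
Qed.

Lemma val_exprz x r i : v x = r%:E -> v (x ^ i) = (i%:~R * r)%:E.
Proof.
have pos (n : nat) y t : v y = t%:E -> v (y ^+ n) = (n%:R * t)%:E.
  move=> yt; elim: n => [|n IHn]; first by rewrite expr0 Defs.val1 mul0r.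
  by rewrite exprS Defs.valM yt IHn -EFinD -natr1; congr _%:E; ring.
move=> xr; case: i => n; first exact: pos.
have -> : x ^ Negz n = x^-1 ^+ n.+1 by rewrite exprVn.
by rewrite (pos _ _ _ (val_inv xr)) NegzE mulrNz mulrN mulNr.
Qed.

Lemma residue_eq0 x : x \in vint v -> (residue v x == 0) = (0 < v x)%E.
Proof.
move=> xv; have -> : 0 = (\pi_(vres v) 0)%qT by apply: esym; exact: rmorph0.
rewrite /residue -Quotient.idealrBE subr0.
by rewrite inE /= val_insubd xv.
Qed.

Lemma lresidueE (f : laurent K) i : lresidue v f i = residue v (f i).
Proof.
rewrite fsfunE; case: finsuppP => // _; apply/esym/eqP.
by rewrite residue_eq0 ?inE val0.
Qed.

(** Dividing by t makes all coefficients integral, and exactly those of minimal valuation become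
    units. *)
Lemma lresidue_scaled_neq0 (f : laurent K) t r i : lval v f = r%:E -> v t = r%:E ->
  lresidue v (lconst t^-1 * f) i != 0 <-> v (f i) = r%:E.
Proof.
move=> fr tr; have vE : v (t^-1 * f i) = (v (f i) - r%:E)%E.
  by rewrite Defs.valM (val_inv tr) addeC.
have := lval_le v f i; rewrite fr => rfi.
rewrite lresidueE lconstM residue_eq0 ?inE vE ?sube_ge0 // ?fin_numE //.
rewrite sube_gt0 // -leNgt; split=> [fir|->//].
by apply/le_anti; rewrite fir.
Qed.

Variable two : rat -> K.
Hypotheses (v2 : v 2%:R = 1%:E) (two_neq0 : forall a, two a != 0).
Hypotheses (twoD : forall a b, two (a + b) = two a * two b) (two1 : two 1 = 2%:R).

(** The map a -> v(2^a) is additive on the rationals, hence linear, and it sends 1 to v(2) = 1. *)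
Lemma val_two a : v (two a) = a%:E.
Proof.
pose r a : rat^o := fine (v (two a)).
have rE b : v (two b) = (r b)%:E by rewrite /r fineK // val_fin.
have rD b c : r (b + c) = r b + r c.
  by have := Defs.valM v (two b) (two c); rewrite -twoD !rE -EFinD => -[].
have rB : zmod_morphism (r : rat^o -> rat^o).
  by move=> b c; apply/eqP; rewrite eq_sym subr_eq -rD subrK.
have := rat_linear rB a 1; rewrite /GRing.scale /= mulr1 => ra.
by rewrite rE ra; have := rE 1; rewrite two1 v2 => -[<-]; rewrite mulr1.
Qed.

Lemma val_lsubst_two l (f : laurent K) i :
  v (lsubst (two l) f i) = (v (f i) + (i%:~R * l)%:E)%E.
Proof. by rewrite lsubstE Defs.valM (val_exprz _ (val_two l)). Qed.

(** The line of index i is the valuation of the i-th coefficient of g(2^l u) as a function of l;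
    [fine] is harmless on the support. *)
Definition newton_lines (g : laurent K) : seq (rat * rat) :=
  [seq (fine (v (g i)), i%:~R) | i <- finsupp g].

Lemma newton_linesP g p : p \in newton_lines g ->
  exists2 i, i \in finsupp g &
    p.2 = i%:~R /\ forall l, v (lsubst (two l) g i) = (line_at p l)%:E.
Proof.
move=> /mapP[i gi ->]; exists i => //; split=> // l.
by rewrite val_lsubst_two -[v (g i)]fineK // val_fin // -mem_finsupp.
Qed.

Lemma newton_linesPr g i : i \in finsupp g ->
  exists2 p, p \in newton_lines g &
    p.2 = i%:~R /\ forall l, v (lsubst (two l) g i) = (line_at p l)%:E.
Proof.
move=> gi; exists (fine (v (g i)), i%:~R); first exact: map_f.
split=> // l.
by rewrite val_lsubst_two -[v (g i)]fineK // val_fin // -mem_finsupp.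
Qed.

Lemma min_lval_lsubst g l :
  mine 2%:R%:E (lval v (lsubst (two l) g)) =
  (envelope (2%:R, 0) (newton_lines g) l)%:E.
Proof.
rewrite /lval finsupp_lsubst // /newton_lines.
have : {subset enum_fset (finsupp g) <= finsupp g} by [].
elim: (enum_fset (finsupp g)) => [|i s IHs] gs.
  by rewrite big_nil /envelope big_nil /line_at mul0r addr0 min_l ?leey.
rewrite big_cons minCA IHs /= ?envelope_cons; last first.
  by move=> j js; apply: gs; rewrite inE js orbT.
rewrite EFin_min val_lsubst_two -[v (g i)]fineK // val_fin // -mem_finsupp.
by apply: gs; rewrite mem_head.
Qed.

End Residue.

(** * Translation of the three claims into statements about the envelope of the constant 2 and the
    lines of g *)

Theorem proposition3p4p4
  (T : realType) (R1 : idomainType) (K : closedFieldType)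
  (iota : {rmorphism {fraction R1} -> K}) (v : valuation K) (two : rat -> K)
  (dvrR1 : is_dvr R1) (completeR1 : adic_complete R1)
  (charK1 : [pchar {fraction R1}] =i pred0)
  (res_charR1 : 2%:R \in nonunits R1)
  (algK : forall x : K, algebraicOver iota x)
  (vintP : forall x : K,
     x \in vint v <-> integralOver (fun r : R1 => iota (tofrac r)) x)
  (v2 : v 2%:R = 1%:E)
  (two_neq0 : forall a, two a != 0)
  (twoD : forall a b, two (a + b) = two a * two b)
  (two1 : two 1 = 2%:R)
  (f h g : laurent K) (alpha : rat)
  (f_over : over_vint v f) (f0_unit : vunit v (f 0))
  (alpha_gt0 : 0 < alpha)
  (f_neg : forall i : int, i < 0 -> ((alpha * `|i|%:~R)%:E <= v (f i))%E)
  (fhg : odd_decomposition f h g) :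
  let wb := wbar T v two f in
  [/\ [/\ continuous_on wb 0 alpha, piecewise_linear_on wb 0 alpha
        & concave_on wb 0 alpha],
      forall a b : rat, 0 <= a -> a < b -> b <= alpha -> constant_on wb a b ->
        (forall l, a <= l <= b -> wb l = 2%:R) /\
        (forall l, a < l < b -> (2%:R%:E < lw v T (lsubst (two l) f))%E)
    & forall l : rat, 0 < l < alpha ->
        let gl := lsubst (two l) g in
        let gamma := lval v gl in
        break_point_on wb 0 alpha l <->
          gamma = 2%:R%:E \/
          (gamma < 2%:R%:E)%E /\
          ~ is_lmonomial (lresidue v (lconst (two (fine gamma))^-1 * gl))].
Proof.
move=> wb.
have vtwo := val_two v2 two_neq0 twoD two1.
have vsubst := val_lsubst_two v2 two_neq0 twoD two1.
have linesP := @newton_linesP _ _ _ v2 two_neq0 twoD two1 g.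
have linesPr := @newton_linesPr _ _ _ v2 two_neq0 twoD two1 g.
have minE := min_lval_lsubst v2 two_neq0 twoD two1 g.
set s := newton_lines v g in linesP linesPr minE; set p0 := (2%:R, 0) in minE.
(* For i < 0 the bound is v(a_i) + i l >= (alpha - l)|i| >= 0. *)
have fl_over l : 0 <= l <= alpha -> over_vint v (lsubst (two l) f).
  move=> /andP[l0 la] i; rewrite inE vsubst; have [i0|i0] := ltP i 0; last first.
    by apply: adde_ge0; [exact: f_over|rewrite lee_fin mulr_ge0 // ler0z].
  apply: le_trans (leeD2r _ (f_neg i i0)); rewrite -EFinD lee_fin.
  have -> : (`|i|%:~R : rat) = - i%:~R by rewrite ltr0_norm // mulrNz.
  have : (i%:~R : rat) < 0 by rewrite ltrz0.
  by nra.
have decomp l := lsubst_odd_decomposition (two_neq0 l) fhg.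
have wbE l : 0 <= l <= alpha -> wb l = ratr (envelope p0 s l).
  move=> lI; rewrite /wb /wbar (min_lw v2 T (fl_over l lI) (decomp l)).
  by rewrite minE.
have p0E l : line_at p0 l = 2%:R by rewrite /line_at mul0r addr0.
(* The slopes are exponents of g, which are odd and therefore nonzero. *)
have slope_neq0 p : p \in s -> p.2 != 0.
  move=> /linesP[i gi [-> _]]; rewrite intr_eq0; apply: contraTneq gi => ->.
  by rewrite mem_finsupp negbK; apply: contraT => /(proj2 fhg); rewrite dvdz0.
have attained l r : r <= 2%:R -> lval v (lsubst (two l) g) = r%:E ->
    envelope p0 s l = r /\ exists p i, [/\ p \in s, p.2 = i%:~R,
      line_at p l = r & v (lsubst (two l) g i) = r%:E].
  move=> r2 lr; have := minE l; rewrite lr min_r ?lee_fin // => -[<-]; split=> //.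
  have [i ir] := lval_attained lr.
  have gi : i \in finsupp g.
    by rewrite -(finsupp_lsubst (two_neq0 l)) mem_finsupp -(val_eqy v) ir.
  have [p ps [pi pl]] := linesPr i gi.
  by exists p, i; split=> //; move: ir; rewrite pl => -[].
split.
- split.
  + exact: envelope_continuous_on wbE.
  + exact: envelope_piecewise_linear_on wbE alpha_gt0.
  + exact: envelope_concave_on wbE.
- move=> a b a0 ab bal wb_cst.
  have env_cst x : a <= x <= b -> envelope p0 s x = envelope p0 s a.
    by move=> xI; have := wb_cst x xI; rewrite !wbE; [move/fmorph_inj|lra..].
  (* A line touching a constant stretch at an interior point lies above it on both sides, so its
     slope is 0; only [p0] qualifies. *)
  have slope0 x p : a < x < b -> p \in p0 :: s -> line_at p x = envelope p0 s x ->
      p = p0.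
    move=> /andP[ax xb]; rewrite inE => /predU1P[//|ps].
    have ps' : p \in p0 :: s by rewrite inE ps orbT.
    have := envelope_le a ps'; have := envelope_le b ps'.
    have bI : a <= b <= b by lra.
    have xI : a <= x <= b by lra.
    rewrite (env_cst b bI) (env_cst x xI) /line_at => pb pa px.
    have : 0 <= p.2 * (b - x) by lra.
    have : 0 <= - p.2 * (x - a) by lra.
    rewrite !pmulr_lge0 ?subr_gt0 // => p1 p2.
    by have /eqP := slope_neq0 p ps; case; lra.
  (* Some line touches at the midpoint; it must be [p0], so the constant is 2. *)
  have ahalf : a < (a + b) / 2%:R < b by lra.
  have env2 : envelope p0 s a = 2%:R.
    rewrite -(env_cst ((a + b) / 2%:R)); last by lra.
    have [p ps pE] := envelope_attained p0 s ((a + b) / 2%:R).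
    by rewrite pE (slope0 _ p ahalf ps (esym pE)) p0E.
  split=> [l lI|l lI]; first by rewrite wbE ?env_cst ?env2 ?ratr_nat //; lra.
  have lI' : 0 <= l <= alpha by lra.
  apply: lt_le_trans (lw_ge v2 T (fl_over l lI') (decomp l)).
  suff : (2%:R%:E < lval v (lsubst (two l) g))%E.
    by case: lval => [r||] //=; rewrite ?ltry // !lte_fin => ?;
      rewrite -(ratr_nat T) ltr_rat.
  have envl : envelope p0 s l = 2%:R by rewrite env_cst ?env2 //; lra.
  (* If v(g(2^l u)) were equal to 2, a line of g with nonzero slope would touch the constant stretch
     at l. *)
  rewrite lt_neqAle; apply/andP; split; last first.
    by rewrite -envl -minE ge_min lexx orbT.
  apply/eqP => /esym/attained[] // _ [p [i [ps _ pl _]]].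
  have := slope0 l p lI; rewrite inE ps orbT envl => /(_ isT pl) pp0.
  by have := slope_neq0 p ps; rewrite pp0 eqxx.
- move=> l lI gl gamma; rewrite (envelope_break_point wbE) //.
  have gamma_ge : (envelope p0 s l)%:E = mine 2%:R%:E gamma by rewrite -minE.
  split.
    move=> [p [q [ps qs pq pE qE]]].
    (* The two slopes differ, so at most one of the lines is [p0]. *)
    wlog ps' : p q ps qs pq pE qE / p \in s.
      move=> H; move: (ps); rewrite inE => /predU1P[pp0|]; last by move=> /(H p q); apply.
      apply: (H q p) => //; first by rewrite eq_sym.
      move: qs pq; rewrite inE => /predU1P[->|//].
      by rewrite pp0 eqxx.
    have [i gi [pi /(_ l) pl]] := linesP p ps'.
    have gamma_le : (gamma <= (envelope p0 s l)%:E)%E by rewrite -pE -pl; exact: lval_le.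
    have gammaE : gamma = (envelope p0 s l)%:E.
      by apply/le_anti; rewrite gamma_le gamma_ge ge_min lexx orbT.
    have env2 : envelope p0 s l <= 2%:R by rewrite -(p0E l) envelope_le ?mem_head.
    move: qs; rewrite inE => /predU1P[qp0|qs].
      by left; rewrite gammaE -qE qp0 p0E.
    move: env2; rewrite le_eqVlt => /predU1P[env2|env2].
      by left; rewrite gammaE env2.
    right; split; first by rewrite gammaE lte_fin.
    (* Both touching lines now come from g: two distinct exponents attain gamma, and both survive in
       the residue after division by 2^gamma. *)
    have [j gj [qj /(_ l) ql]] := linesP q qs.
    have resP k := lresidue_scaled_neq0 k gammaE (vtwo _).
    rewrite gammaE /=.
    have ri : v (gl i) = (envelope p0 s l)%:E by rewrite pl pE.
    have rj : v (gl j) = (envelope p0 s l)%:E by rewrite ql qE.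
    move=> /(is_lmonomialP ((resP i).2 ri)) /(_ j ((resP j).2 rj)) ij.
    by move: pq; rewrite pi qj ij eqxx.
  move=> [gamma2|[gamma2 nmono]].
    (* For gamma = 2, a line of g meets the constant line [p0] at height 2. *)
    have [envl [p [i [ps pi pl _]]]] := attained l _ (lexx _) gamma2.
    by exists p, p0; split; rewrite ?inE ?eqxx ?ps ?orbT ?slope_neq0 ?envl.
  have [r gammaE] : exists r, gamma = r%:E.
    move: gamma_ge gamma2; rewrite /gamma; case: lval => [r|//|]; first by exists r.
    by rewrite minEle.
  have r2 : r <= 2%:R by rewrite ltW // -lte_fin -gammaE.
  have [envl [p [i [ps pi pl ri]]]] := attained l r r2 gammaE.
  have resP k := lresidue_scaled_neq0 k gammaE (vtwo r).
  move: nmono; rewrite gammaE /= => /(is_lmonomialP ((resP i).2 ri)).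
  (* Not being a monomial yields a second exponent j attaining gamma, hence a second touching line
     of a different slope. *)
  move=> /existsNP[j /not_implyP[/resP rj /eqP ji]].
  have gj : j \in finsupp g.
    by rewrite -(finsupp_lsubst (two_neq0 l)) mem_finsupp -(val_eqy v) rj.
  have [q qs [qj /(_ l) ql]] := linesPr j gj.
  exists p, q; split; rewrite ?inE ?ps ?qs ?orbT //.
  - by rewrite pi qj (inj_eq intr_inj) eq_sym.
  - by rewrite envl.
  - by move: ql; rewrite envl rj => -[].
Qed.
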